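(* If $G'=\{x\rightarrow y,\ y\rightarrow x\}$, then for $n\geqslant 1$ $$(xyD_{G'})^n=\sum_{k=1}^n\sum_{\ell=0}^{\lfloor(2n-k)/2\rfloor}B_{n,k,\ell}x^{k+2\ell} y^{2n-k-2\ell}D_{G'}^k,$$ where the coefficients $B_{n,k,\ell}$ satisfy the recurrence relation $$B_{n+1,k,\ell}=(k+2\ell) B_{n,k,\ell}+(2n-k-2\ell+2)B_{n,k,\ell-1}+B_{n,k-1,\ell},$$ with the initial conditions $B_{1,1,0}=1$ and $B_{1,k,\ell}=0$ if $(k,\ell)\neq (1,0)$.
   Context: Grammars: a grammar $G$ on commuting variables is a set of substitution rules $v\rightarrow f_v$; $D_G$ is the derivation (linear, Leibniz rule, killing constants) on functions (e.g. polynomials) in the variables with $D_G(v)=f_v$. For a function $w$, $wD_G$ is the operator $f\mapsto wD_G(f)$, and $(wD_G)^n$ is its $n$-fold composition; in expansions $\sum_k c_kD_G^k$ the functions $c_k$ act by multiplication. *)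

(* Defs.v *)
From HB Require Import structures.
From mathcomp Require Import all_boot all_order all_algebra.
From mathcomp Require Import mpoly.

Set Implicit Arguments.
Unset Strict Implicit.
Unset Printing Implicit Defensive.

Import GRing.Theory.
Local Open Scope ring_scope.

Section Grammar.

Variables (K : comNzRingType) (A : comAlgType K).

(* [A] is a K-algebra of functions in the variables, each variable being
   identified with the corresponding element of [A]; the pair [(v, f_v)] is the
   substitution rule v -> f_v. *)
Definition grammar := seq (A * A).

Definition grammar_derivation (G : grammar) (D : A -> A) : Prop :=
  [/\ linear D,
      forall f g, D (f * g) = D f * g + f * D g,
      forall c : K, D c%:A = 0
    & forall rule, rule \in G -> D rule.1 = rule.2].

Definition mulD (w : A) (D : A -> A) : A -> A := fun f => w * D f.

End Grammar.

(* On polynomials every grammar has such a derivation, namely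
   p |-> \sum_i f_i * (dp / dX_i). *)
Section Polynomials.

Variables (K : comNzRingType) (m : nat) (F : 'I_m -> {mpoly K[m]}).

Definition mpoly_grammar : grammar {mpoly K[m]} :=
  [seq ('X_i, F i) | i <- enum 'I_m].

Definition mpolyD (p : {mpoly K[m]}) : {mpoly K[m]} := \sum_i F i * p^`M(i).

Lemma mpolyD_grammar_derivation : grammar_derivation mpoly_grammar mpolyD.
Proof.
split=> [a p q|p q|c|rule].
- rewrite /mpolyD scaler_sumr -big_split; apply: eq_bigr => i _ /=.
  by rewrite mderivD mderivZ mulrDr scalerAr.
- rewrite /mpolyD mulr_suml mulr_sumr -big_split; apply: eq_bigr => i _ /=.
  by rewrite mderivM mulrDr !mulrA [F i * p]mulrC.
- rewrite /mpolyD big1 // => i _.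
  by rewrite mderivZ -mpolyC1 mderivC scaler0 mulr0.
case/mapP=> i _ -> /=; rewrite /mpolyD (bigD1 i) //= big1 ?addr0 => [|j ji].
  by rewrite mderivX mnm1E eqxx -{1}[U_(i)%MM]addm0 addmC addmK mpolyX0 scale1r mulr1.
by rewrite mderivX mnm1E eq_sym (negbTE ji) scale0r mulr0.
Qed.

End Polynomials.

(* Main.v *)
Require Import Defs.
From mathcomp Require Import all_boot all_order all_algebra.
From mathcomp Require Import ring zify.

Set Implicit Arguments.
Unset Strict Implicit.
Unset Printing Implicit Defensive.

Import GRing.Theory.
Local Open Scope ring_scope.

(** The operator [x y D] acts on one summand [x^a y^b D^k] by the Leibniz rule:
    since [D x = y] and [D y = x],
      [x y D (x^a y^b D^k f) = a x^a y^(b+2) D^k f + b x^(a+2) y^b D^k f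
                               + x^(a+1) y^(b+1) D^(k+1) f].
    For [a = k + 2 l] and [b = 2 n - k - 2 l] these three monomials are the
    ones of index [(k, l)], [(k, l + 1)] and [(k + 1, l)] at level [n + 1], so
    collecting coefficients gives exactly the three terms of the recurrence,
    and the expansion follows by induction on [n] ([iter_mulD_expansion]).

    Two devices keep the induction simple.  It starts at [n = 0], from the
    identity operator with coefficient 1 at [(0, 0)]; the recurrence sends this
    to the prescribed value at [n = 1] ([coef1]).  And the sums run over a
    fixed square of indices [k, l < N], large enough to contain the support of
    the coefficients ([coef_eq0]), so that shifting an index only adds and
    removes zeros.  The range of summation in the theorem is recovered at the
    end, the coefficients outside of it being zero. *)

Fixpoint coef (n : nat) (k l : int) : int :=
  if n is m.+1 then
    (k + 2 * l) * coef m k l + (2 * m%:Z - k - 2 * l + 2) * coef m k (l - 1)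
    + coef m (k - 1) l
  else ((k, l) == (0, 0))%:R.

Lemma coefS n k l : coef n.+1 k l =
  (k + 2 * l) * coef n k l + (2 * n%:Z - k - 2 * l + 2) * coef n k (l - 1)
  + coef n (k - 1) l.
Proof. by []. Qed.

(** Both factors in front of the entry [(0, 0)] of level 0 vanish: [k + 2 l]
    at [(0, 0)] and [2 - k - 2 l] at [(0, 1)].  Only the shift in [k] is left. *)
Lemma coef1 k l : coef 1 k l = ((k, l) == (1, 0))%:R.
Proof.
rewrite coefS /= !xpair_eqE.
have [->|k0] := eqVneq k 0; last first.
  by rewrite /= !mulr0 !add0r; lia.
have [->|l0] := eqVneq l 0; first by lia.
by have [->|l1] := eqVneq l 1; lia.
Qed.

(** Each shift of the recurrence carries the region [0 <= k <= n], [0 <= l],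
    [k + 2 l <= 2 n] of level [n] into the one of level [n + 1]. *)
Lemma coef_eq0 n (k l : int) :
  [|| k < 0, n%:Z < k, l < 0 | 2 * n%:Z < k + 2 * l] -> coef n k l = 0.
Proof.
elim: n k l => [|n IHn] k l out.
  by rewrite /= xpair_eqE; case: eqVneq => // k0; case: eqVneq => // l0; lia.
by rewrite coefS !IHn ?mulr0 ?addr0 //; lia.
Qed.

Lemma coef_col0 n l : coef n.+1 0 l = 0.
Proof.
elim: n l => [|n IHn] l; first by rewrite coef1.
by rewrite coefS !IHn coef_eq0 ?mulr0 ?addr0.
Qed.

Lemma sum_shift (V : nmodType) (h : nat -> V) N : h 0%N = 0 -> h N = 0 ->
  \sum_(0 <= i < N) h i.+1 = \sum_(0 <= i < N) h i.
Proof.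
move=> h0 hN.
by rewrite -[LHS]add0r -{1}h0 -big_nat_recl // big_nat_recr //= hN addr0.
Qed.

Section Derivation.

Variables (K : comNzRingType) (A : comAlgType K) (G : grammar A) (D : A -> A).
Hypothesis derD : grammar_derivation G D.

Lemma derivation_add f g : D (f + g) = D f + D g.
Proof. by case: derD => linD _ _ _; have := linD 1 f g; rewrite !scale1r. Qed.

Lemma derivation_int (c : int) : D c%:~R = 0.
Proof.
by case: derD => _ _ const _; have := const c%:~R; rewrite scaler_int.
Qed.

Lemma derivation_sum I (r : seq I) (F : I -> A) :
  D (\sum_(i <- r) F i) = \sum_(i <- r) D (F i).
Proof. exact: (big_morph D derivation_add (derivation_int 0)). Qed.

(** Multiplying by [v] avoids the exponent [a - 1], hence a case for [a = 0]. *)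
Lemma derivation_exp v a : v * D (v ^+ a) = a%:R * v ^+ a * D v.
Proof.
case: derD => _ leib _ _; elim: a => [|a IHa].
  by rewrite expr0 (derivation_int 1) mulr0 !mul0r.
rewrite exprS leib mulrDr (mulrCA v v) IHa -natr1; ring.
Qed.

End Derivation.

Section Expansion.

Variables (K : comNzRingType) (A : comAlgType K) (x y : A) (D : A -> A).
Hypothesis derD : grammar_derivation [:: (x, y); (y, x)] D.

Lemma mulD_monomial (c : int) a b g :
  mulD (x * y) D (c%:~R * x ^+ a * y ^+ b * g) =
    (a%:Z * c)%:~R * x ^+ a * y ^+ b.+2 * g
    + (b%:Z * c)%:~R * x ^+ a.+2 * y ^+ b * g
    + c%:~R * x ^+ a.+1 * y ^+ b.+1 * D g.
Proof.
have := derivation_exp derD x a; have := derivation_exp derD y b.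
have D0 := derivation_int derD c; case: derD => _ leib _ rules.
have Dx : D x = y by apply: (rules (x, y)); rewrite inE eqxx.
have Dy : D y = x by apply: (rules (y, x)); rewrite !inE eqxx orbT.
rewrite Dx Dy /mulD !leib D0 => Eb Ea.
transitivity (c%:~R * (x * D (x ^+ a)) * y ^+ b.+1 * g
   + c%:~R * x ^+ a.+1 * (y * D (y ^+ b)) * g
   + c%:~R * x ^+ a.+1 * y ^+ b.+1 * D g); first by rewrite !exprS; ring.
rewrite Ea Eb !intrM !exprS; ring.
Qed.

Definition monomial (n k l : nat) : A := x ^+ (k + 2 * l) * y ^+ (2 * n - k - 2 * l).

(** Outside the support of [coef] the truncated exponents of [monomial] are
    meaningless, but there both sides vanish. *)
Lemma mulD_term (n k l : nat) g :
  mulD (x * y) D ((coef n k l)%:~R * monomial n k l * g) =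
    ((k%:Z + 2 * l%:Z) * coef n k l)%:~R * monomial n.+1 k l * g
    + ((2 * n%:Z - k%:Z - 2 * l.+1%:Z + 2) * coef n k (l.+1%:Z - 1))%:~R
      * monomial n.+1 k l.+1 * g
    + (coef n (k.+1%:Z - 1) l)%:~R * monomial n.+1 k.+1 l * D g.
Proof.
have predS (m : nat) : m.+1%:Z - 1 = m%:Z by lia.
rewrite !predS; have [le_kl|gt_kl] := leqP (k + 2 * l) (2 * n); last first.
  rewrite coef_eq0; last by lia.
  by rewrite !mulr0 !mul0r /mulD (derivation_int derD 0) mulr0 !addr0.
rewrite /monomial !mulrA mulD_monomial.
have -> : (2 * n.+1 - k - 2 * l = (2 * n - k - 2 * l).+2)%N by lia.
have -> : (2 * n.+1 - k - 2 * l.+1 = 2 * n - k - 2 * l)%N by lia.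
have -> : (2 * n.+1 - k.+1 - 2 * l = (2 * n - k - 2 * l).+1)%N by lia.
have -> : (k + 2 * l.+1 = (k + 2 * l).+2)%N by lia.
have -> : 2 * n%:Z - k%:Z - 2 * l.+1%:Z + 2 = (2 * n - k - 2 * l)%N%:Z by lia.
by have -> : k%:Z + 2 * l%:Z = (k + 2 * l)%N%:Z by lia.
Qed.

Lemma iter_mulD_expansion n N f : (n < N)%N ->
  iter n (mulD (x * y) D) f =
  \sum_(0 <= k < N) \sum_(0 <= l < N)
    (coef n k l)%:~R * monomial n k l * iter k D f.
Proof.
elim: n => [|n IHn] ltnN.
  case: N ltnN => // N _; rewrite big_nat_recl // big_nat_recl //=.
  rewrite /monomial !mul1r !big1 ?addr0 // => [k _|l _]; last by rewrite !mul0r.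
  by rewrite big1 // => l _; rewrite !mul0r.
rewrite iterS IHn; last by lia.
rewrite /mulD (derivation_sum derD) mulr_sumr.
under eq_bigr => k _.
  rewrite (derivation_sum derD) mulr_sumr.
  under eq_bigr => l _ do rewrite -/(mulD _ _ _) mulD_term -iterS.
  rewrite !big_split /=.
  (* The second term moves from [l + 1] to [l]. *)
  rewrite (sum_shift (h := fun l : nat =>
    ((2 * n%:Z - k%:Z - 2 * l%:Z + 2) * coef n k (l%:Z - 1))%:~R
      * monomial n.+1 k l * iter k D f)); first last.
  - by rewrite coef_eq0 ?mulr0 ?mul0r //; lia.
  - by rewrite coef_eq0 ?mulr0 ?mul0r //; lia.
  over.
rewrite !big_split /=.
(* The third term moves from [k + 1] to [k]. *)
rewrite (sum_shift (h := fun k : nat => \sum_(0 <= l < N)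
  (coef n (k%:Z - 1) l)%:~R * monomial n.+1 k l * iter k D f)); first last.
- by rewrite big1 // => l _; rewrite coef_eq0 ?mul0r //; lia.
- by rewrite big1 // => l _; rewrite coef_eq0 ?mul0r //; lia.
rewrite -!big_split; apply: eq_bigr => k _ /=.
rewrite -!big_split; apply: eq_bigr => l _ /=.
by rewrite -!mulrDl -!intrD.
Qed.

End Expansion.

Theorem proposition20 :
  exists B : nat -> int -> int -> int,
    [/\ B 1%N 1 0 = 1,
        forall k l : int, (k, l) != (1, 0) -> B 1%N k l = 0,
        forall (n : nat) (k l : int), (1 <= n)%N ->
          B n.+1 k l = (k + 2 * l) * B n k l
                     + (2 * n%:Z - k - 2 * l + 2) * B n k (l - 1)
                     + B n (k - 1) l
      & forall (K : comNzRingType) (A : comAlgType K) (x y : A) (D : A -> A),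
          grammar_derivation [:: (x, y); (y, x)] D ->
          forall n : nat, (1 <= n)%N ->
          forall f : A,
            iter n (mulD (x * y) D) f =
            \sum_(1 <= k < n.+1) \sum_(0 <= l < ((2 * n - k)./2).+1)
              (B n k%:Z l%:Z)%:~R * x ^+ (k + 2 * l) * y ^+ (2 * n - k - 2 * l)
              * iter k D f].
Proof.
exists coef; split=> [||//|K A x y D derD [//|n] _ f].
- by rewrite coef1.
- by move=> k l /negPf ne; rewrite coef1 ne.
rewrite (iter_mulD_expansion derD f (ltnSn n.+1)) big_ltn //.
rewrite big1 ?add0r => [|l _]; last by rewrite coef_col0 !mul0r.
apply: eq_big_nat => k /andP[k_gt0 _]; rewrite -divn2.
rewrite (@big_cat_nat _ _ _ ((2 * n.+1 - k) %/ 2).+1) //; last by lia.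
rewrite [X in _ + X = _]big1_seq ?addr0.
  by apply: eq_bigr => l _; rewrite /monomial !mulrA.
move=> l; rewrite mem_index_iota => /andP[_ /andP[lt_l _]].
by rewrite coef_eq0 ?mul0r //; lia.
Qed.
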